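(* Let $\mathcal{A}\in\{0,\ast,?\}^{n\times n}$, $\mathcal{L}\in\{0,\ast,?\}^{n\times q}$, $\mathcal{C}\in\{0,\ast,?\}^{p\times n}$ be pattern matrices, let $\mathcal{L}_i$ denote the $i$th column of $\mathcal{L}$, and suppose that the index $\eta_i$ of $(\mathcal{A},\mathcal{L}_i,\mathcal{C})$ exists for all $i=1,2,\ldots,q$. Let $$\mathcal{R}:=\begin{bmatrix}\mathcal{C}\mathcal{A}^{\eta_1-1}\mathcal{L}_1 & \mathcal{C}\mathcal{A}^{\eta_2-1}\mathcal{L}_2 & \cdots & \mathcal{C}\mathcal{A}^{\eta_q-1}\mathcal{L}_q\end{bmatrix}\in\{0,\ast,?\}^{p\times q}.$$ The FDI problem for $(\mathcal{A},\mathcal{L},\mathcal{C})$ is solvable if $\mathcal{R}$ has full column rank.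
   Context: A pattern matrix is a matrix with entries in the set of symbols $\{0,\ast,?\}$. The pattern class of $\mathcal{M}\in\{0,\ast,?\}^{r\times s}$ is $\mathcal{P}(\mathcal{M}):=\{M\in\mathbb{R}^{r\times s} \mid M_{ij}=0 \text{ if } \mathcal{M}_{ij}=0,\ M_{ij}\neq 0\text{ if }\mathcal{M}_{ij}=\ast\}$ (entries at positions with $?$ are arbitrary reals). A pattern matrix $\mathcal{R}$ has full column rank if every matrix in $\mathcal{P}(\mathcal{R})$ has full column rank. The linear structured system $(\mathcal{A},\mathcal{L},\mathcal{C})$ is the family of systems $(A,L,C)$ (that is, $\dot x=Ax+Lf$, $y=Cx$) with $A\in\mathcal{P}(\mathcal{A})$, $L\in\mathcal{P}(\mathcal{L})$, $C\in\mathcal{P}(\mathcal{C})$; one writes $(A,L,C)\in(\mathcal{A},\mathcal{L},\mathcal{C})$. Solvability for a real system: for $A\in\mathbb{R}^{n\times n}$, $L\in\mathbb{R}^{n\times q}$ with columns $L_i$, $C\in\mathbb{R}^{p\times n}$, and $G\in\mathbb{R}^{n\times p}$, let $\mathcal{V}_i$ be the smallest $(A+GC)$-invariant subspace of $\mathbb{R}^n$ containing $\operatorname{im}L_i$. The FDI (fault detection and isolation) problem for $(A,L,C)$ is solvable if there exists $G\in\mathbb{R}^{n\times p}$ such that the family $\{C\mathcal{V}_i\}_{i=1}^q$ is independent, meaning that $C\mathcal{V}_i\neq\{0\}$ and $C\mathcal{V}_i\cap\big(\sum_{j\neq i}C\mathcal{V}_j\big)=\{0\}$ for all $i=1,\ldots,q$.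 The FDI problem for $(\mathcal{A},\mathcal{L},\mathcal{C})$ is solvable if it is solvable for every $(A,L,C)\in(\mathcal{A},\mathcal{L},\mathcal{C})$. Operations on $\{0,\ast,?\}$ (both commutative): $0+x=x$ for all $x$; $\ast+\ast=?$, $\ast+?=?$, $?+?=?$; $0\cdot x=0$ for all $x$; $\ast\cdot\ast=\ast$, $\ast\cdot ?=?$, $?\cdot ?=?$. For $\mathcal{M}\in\{0,\ast,?\}^{r\times s}$, $\mathcal{N}\in\{0,\ast,?\}^{s\times t}$, the product is $(\mathcal{M}\mathcal{N})_{ij}:=\sum_{k=1}^{s}\mathcal{M}_{ik}\cdot\mathcal{N}_{kj}$. For square $\mathcal{M}$, $\mathcal{M}^0=\mathcal{I}$ (the pattern matrix with $\ast$ on the diagonal and $0$ elsewhere) and $\mathcal{M}^k=\mathcal{M}^{k-1}\mathcal{M}$. $\mathcal{O}$ denotes a pattern matrix with all entries $0$. Index: the index of $(\mathcal{A},\mathcal{L}_i,\mathcal{C})$ is the positive integer $\eta_i$ (if it exists) such that $\mathcal{C}\mathcal{A}^j\mathcal{L}_i=\mathcal{O}$ for $j=0,1,\ldots,\eta_i-2$ and $\mathcal{C}\mathcal{A}^{\eta_i-1}\mathcal{L}_i\neq\mathcal{O}$. If no such positive integer exists, the index is said not to exist. *)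

(* Defs.v *)
From HB Require Import structures.
From mathcomp Require Export all_boot all_order all_algebra.
From mathcomp Require Export reals.

Set Implicit Arguments.
Unset Strict Implicit.
Unset Printing Implicit Defensive.

Import GRing.Theory.
Local Open Scope ring_scope.

(* [Zero] is the symbol 0, [Star] is the symbol * and [Any] is the symbol ?. *)
Inductive symbol := Zero | Star | Any.

Definition symbol_code (x : symbol) : option bool :=
  match x with Zero => None | Star => Some true | Any => Some false end.

Definition symbol_decode (o : option bool) : symbol :=
  match o with None => Zero | Some true => Star | Some false => Any end.

Lemma symbol_codeK : cancel symbol_code symbol_decode.
Proof. by case. Qed.

HB.instance Definition _ := Countable.copy symbol (can_type symbol_codeK).

Definition symbol_add (x y : symbol) : symbol :=
  match x, y with
  | Zero, z | z, Zero => z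
  | _, _ => Any
  end.

Definition symbol_mul (x y : symbol) : symbol :=
  match x, y with
  | Zero, _ | _, Zero => Zero
  | Star, Star => Star
  | _, _ => Any
  end.

Lemma symbol_addA : associative symbol_add.
Proof. by case; case; case. Qed.

Lemma symbol_addC : commutative symbol_add.
Proof. by case; case. Qed.

Lemma symbol_add0 : left_id Zero symbol_add.
Proof. by case. Qed.

HB.instance Definition _ :=
  GRing.isNmodule.Build symbol symbol_addA symbol_addC symbol_add0.

Lemma symbol_mulA : associative symbol_mul.
Proof. by case; case; case. Qed.

Lemma symbol_mulC : commutative symbol_mul.
Proof. by case; case. Qed.

Lemma symbol_mul1 : left_id Star symbol_mul.
Proof. by case. Qed.

Lemma symbol_mulDl : left_distributive symbol_mul symbol_add.
Proof. by case; case; case. Qed.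

Lemma symbol_mul0 : left_zero Zero symbol_mul.
Proof. by case. Qed.

Lemma symbol_star_neq0 : Star != Zero.
Proof. by []. Qed.

(* The symbols form a commutative semiring whose zero is 0 and whose one is *.
   So [*m] and [^+] on matrices over [symbol] are the product and the powers of
   pattern matrices, [0] is the all-0 pattern, and [A ^+ 0 = 1%:M] is the
   pattern with * on the diagonal and 0 elsewhere. *)
HB.instance Definition _ :=
  GRing.Nmodule_isComNzSemiRing.Build symbol
    symbol_mulA symbol_mulC symbol_mul1 symbol_mulDl symbol_mul0
    symbol_star_neq0.

Definition in_pattern_class (R : realType) (r s : nat)
    (P : 'M[symbol]_(r, s)) (M : 'M[R]_(r, s)) : Prop :=
  forall i j, (P i j = Zero -> M i j = 0) /\ (P i j = Star -> M i j <> 0).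

Definition pattern_full_column_rank (R : realType) (r s : nat)
    (P : 'M[symbol]_(r, s)) : Prop :=
  forall M : 'M[R]_(r, s), in_pattern_class P M -> \rank M = s.

(* The linear map x |-> M x on column vectors. *)
Definition mxlin (R : realType) (m n : nat) (M : 'M[R]_(m, n)) :
    'Hom('cV[R]_n, 'cV[R]_m) :=
  linfun (mulmx M : 'cV[R]_n -> 'cV[R]_m).

Definition invariant_over (R : realType) (n : nat) (F : 'M[R]_n)
    (U V : {vspace 'cV[R]_n}) : Prop :=
  (mxlin F @: V <= V)%VS /\ (U <= V)%VS.

Definition smallest_invariant_over (R : realType) (n : nat) (F : 'M[R]_n)
    (U V : {vspace 'cV[R]_n}) : Prop :=
  invariant_over F U V /\
  (forall W : {vspace 'cV[R]_n}, invariant_over F U W -> (V <= W)%VS).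

Definition independent_family (R : realType) (p q : nat)
    (W : 'I_q -> {vspace 'cV[R]_p}) : Prop :=
  forall i : 'I_q,
    W i <> 0%VS /\ (W i :&: \sum_(j < q | j != i) W j)%VS = 0%VS.

(* The family [V] below is uniquely determined by [G]. *)
Definition FDI_solvable_system (R : realType) (n q p : nat)
    (A : 'M[R]_n) (L : 'M[R]_(n, q)) (C : 'M[R]_(p, n)) : Prop :=
  exists (G : 'M[R]_(n, p)) (V : 'I_q -> {vspace 'cV[R]_n}),
    (forall i, smallest_invariant_over (A + G *m C) (limg (mxlin (col i L)))
                 (V i)) /\
    independent_family (fun i => (mxlin C @: V i)%VS).

Definition FDI_solvable (R : realType) (n q p : nat)
    (A : 'M[symbol]_n) (L : 'M[symbol]_(n, q)) (C : 'M[symbol]_(p, n)) : Prop :=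
  forall (A0 : 'M[R]_n) (L0 : 'M[R]_(n, q)) (C0 : 'M[R]_(p, n)),
    in_pattern_class A A0 -> in_pattern_class L L0 -> in_pattern_class C C0 ->
    FDI_solvable_system A0 L0 C0.

(* The range j = 0, ..., eta - 2 is written [j.+1 < eta]: with truncated
   subtraction, [j <= eta - 2] would wrongly include j = 0 when eta = 1. *)
Definition is_index (n p : nat) (A : 'M[symbol]_n) (l : 'cV[symbol]_n)
    (C : 'M[symbol]_(p, n)) (eta : nat) : Prop :=
  [/\ (0 < eta)%N,
      forall j : nat, (j.+1 < eta)%N -> C *m A ^+ j *m l = 0
    & C *m A ^+ (eta - 1) *m l <> 0].

Definition index_pattern (n q p : nat) (A : 'M[symbol]_n)
    (L : 'M[symbol]_(n, q)) (C : 'M[symbol]_(p, n)) (eta : 'I_q -> nat) :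
    'M[symbol]_(p, q) :=
  \matrix_(i < p, j < q) (C *m A ^+ (eta j - 1) *m col j L) i 0.

(* Main.v *)
Require Import Defs.

Set Implicit Arguments.
Unset Strict Implicit.
Unset Printing Implicit Defensive.

Import GRing.Theory.
Local Open Scope ring_scope.

(** For a real system in the class, put [d_i = C A^(eta_i - 1) L_i]. These
    columns form a matrix in the class of the index pattern, so they are linearly
    independent and there is [G] with [G d_i = - A^(eta_i) L_i] for all [i]. As
    [C A^j L_i = 0] for [j < eta_i - 1], the powers of [A + G C] agree with those
    of [A] on [L_i] up to exponent [eta_i - 1], and the next step gives [0].
    Hence [V_i] is spanned by the [A^j L_i] with [j < eta_i], and [C V_i] is the
    line spanned by [d_i]. *)

(** The condition of [in_pattern_class] on a single entry, isolated so that it can be carried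
    through the sums of a matrix product. *)
Definition matches (R : realType) (s : symbol) (x : R) : Prop :=
  (s = Zero -> x = 0) /\ (s = Star -> x <> 0).

(** A sum of two nonzero symbols is [Any], which constrains nothing, so only the cases with a [Zero]
    summand remain. *)
Lemma matches_add (R : realType) (s t : symbol) (x y : R) :
  matches s x -> matches t y -> matches (s + t) (x + y).
Proof.
case: s; case: t => -[s0 s1] [t0 t1]; split=> //= _.
- by rewrite s0 // t0 // addr0.
- by rewrite s0 // add0r; apply: t1.
- by rewrite t0 // addr0; apply: s1.
Qed.

Lemma matches_mul (R : realType) (s t : symbol) (x y : R) :
  matches s x -> matches t y -> matches (s * t) (x * y).
Proof.
case: s; case: t => -[s0 s1] [t0 t1]; split=> //= _;
  try by [rewrite s0 // mul0r | rewrite t0 // mulr0].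
by apply/eqP; rewrite mulf_neq0 //; apply/eqP; [apply: s1 | apply: t1].
Qed.

Lemma in_pattern_class_mulmx (R : realType) (m n p : nat)
    (P : 'M[symbol]_(m, n)) (Q : 'M[symbol]_(n, p))
    (M : 'M[R]_(m, n)) (N : 'M[R]_(n, p)) :
  in_pattern_class P M -> in_pattern_class Q N ->
  in_pattern_class (P *m Q) (M *m N).
Proof.
move=> PM QN i j; rewrite !mxE.
apply: (big_ind2 (@matches R)) => [|s x t y|k _]; first by split.
- exact: matches_add.
- exact: matches_mul (PM i k) (QN k j).
Qed.

Lemma in_pattern_class1 (R : realType) (n : nat) :
  in_pattern_class (1%:M : 'M[symbol]_n) (1%:M : 'M[R]_n).
Proof.
by move=> i j; rewrite !mxE; case: (i == j); split=> //= _; apply/eqP/oner_neq0.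
Qed.

Lemma in_pattern_class_exp (R : realType) (n k : nat)
    (P : 'M[symbol]_n) (M : 'M[R]_n) :
  in_pattern_class P M -> in_pattern_class (P ^+ k) (M ^+ k).
Proof.
move=> PM; elim: k => [|k IHk]; first exact: in_pattern_class1.
by rewrite !exprS; apply: in_pattern_class_mulmx.
Qed.

Lemma in_pattern_class_col (R : realType) (m n : nat) (j : 'I_n)
    (P : 'M[symbol]_(m, n)) (M : 'M[R]_(m, n)) :
  in_pattern_class P M -> in_pattern_class (col j P) (col j M).
Proof. by move=> PM i k; rewrite !mxE; apply: PM. Qed.

Lemma in_pattern_class0 (R : realType) (m n : nat) (M : 'M[R]_(m, n)) :
  in_pattern_class 0 M -> M = 0.
Proof. by move=> M0; apply/matrixP=> i j; rewrite mxE; apply: (M0 i j).1; rewrite mxE. Qed.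

Lemma mxlinE (R : realType) (m n : nat) (M : 'M[R]_(m, n)) (x : 'cV[R]_n) :
  mxlin M x = M *m x.
Proof. by rewrite lfunE. Qed.

Lemma full_column_rank_left_inverse (F : fieldType) (m n : nat)
    (M : 'M[F]_(m, n)) :
  \rank M = n -> exists B : 'M[F]_(n, m), B *m M = 1%:M.
Proof.
move=> rM; have /row_freeP [B MB]: row_free M^T by rewrite /row_free mxrank_tr rM.
by exists B^T; apply: trmx_inj; rewrite trmx_mul trmxK MB trmx1.
Qed.

(** The domain of [mxlin l] consists of 1 by 1 matrices, which act on [l] as scalars. *)
Lemma limg_mxlin_col (R : realType) (n : nat) (l : 'cV[R]_n) :
  limg (mxlin l) = <[l]>%VS.
Proof.
apply/vspaceP=> v; apply/memv_imgP/vlineP => [[x _ ->]|[a ->]].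
- by exists (x 0 0); rewrite mxlinE [in LHS](mx11_scalar x) mul_mx_scalar.
- by exists a%:M; rewrite ?memvf // mxlinE mul_mx_scalar.
Qed.

Section OutputInjection.

Variables (R : realType) (n p : nat) (A : 'M[R]_n) (l : 'cV[R]_n).
Variables (C : 'M[R]_(p, n)) (G : 'M[R]_(n, p)) (k : nat).
Hypothesis C_chain0 : forall j, (j < k)%N -> C *m A ^+ j *m l = 0.
Hypothesis G_stop : G *m (C *m A ^+ k *m l) = - (A ^+ k.+1 *m l).

Let F := A + G *m C.

(** Here [k] stands for [eta_i - 1], so both exponents 0 and [k] occur. *)
Definition chain : seq 'cV[R]_n := [seq A ^+ j *m l | j <- iota 0 k.+1].

Lemma mem_chain j : (j <= k)%N -> A ^+ j *m l \in chain.
Proof. by move=> le_jk; apply/mapP; exists j; rewrite ?mem_iota. Qed.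

Lemma injection_step j : (j < k)%N -> F *m (A ^+ j *m l) = A ^+ j.+1 *m l.
Proof.
move=> lt_jk; rewrite mulmxDl -(mulmxA G) (mulmxA C) C_chain0 // mulmx0 addr0.
by rewrite exprS mulmxA.
Qed.

Lemma injection_stop : F *m (A ^+ k *m l) = 0.
Proof. by rewrite mulmxDl -(mulmxA G) (mulmxA C) G_stop exprS mulmxA subrr. Qed.

(** [F] shifts each chain vector to the next and kills the last one, which makes the span
    invariant. *)
Lemma chain_smallest_invariant :
  smallest_invariant_over F (limg (mxlin l)) <<chain>>%VS.
Proof.
rewrite limg_mxlin_col; split=> [|W [FW]]; first split.
- rewrite limg_span; apply/span_subvP=> _ /mapP[_ /mapP[j jk ->] ->].
  rewrite mxlinE; move: jk; rewrite mem_iota add0n ltnS [(j <= k)%N]leq_eqVlt.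
  case/predU1P=> [->|lt_jk]; first by rewrite injection_stop mem0v.
  by rewrite injection_step // memv_span // mem_chain.
- by rewrite -memvE -[l]mul1mx memv_span // (mem_chain (leq0n k)).
(* Minimality: an invariant [W] containing [l] contains the chain by induction, each vector being
   the image under [F] of the previous one. *)
rewrite -memvE => lW; apply/span_subvP=> _ /mapP[j jk ->].
move: jk; rewrite mem_iota ltnS /=; elim: j => [|j IHj] le_jk.
  by rewrite expr0 mul1mx.
rewrite -injection_step // -mxlinE; apply: (subvP FW).
by apply/memv_img/IHj/ltnW.
Qed.

(** [C] kills every chain vector except the last. *)
Lemma output_chain : (mxlin C @: <<chain>>)%VS = <[C *m A ^+ k *m l]>%VS.
Proof.
rewrite limg_span; apply/eqP; rewrite eqEsubv; apply/andP; split.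
- apply/span_subvP=> _ /mapP[_ /mapP[j jk ->] ->]; rewrite mxlinE mulmxA.
  move: jk; rewrite mem_iota add0n ltnS [(j <= k)%N]leq_eqVlt; case/predU1P=> [->|lt_jk].
    exact: memv_line.
  by rewrite C_chain0 // mem0v.
- rewrite -memvE -mulmxA -mxlinE; apply/memv_span/map_f.
  exact: mem_chain.
Qed.

End OutputInjection.

(** A left inverse [B] of [D] reads off coordinates: entry [i] of [B *m x] is the coefficient of
    column [i] in [x], for [x] in the column space. *)
Lemma independent_lines (R : realType) (p q : nat) (D : 'M[R]_(p, q)) :
  \rank D = q -> independent_family (fun i => <[col i D]>%VS).
Proof.
case/full_column_rank_left_inverse=> B BD i.
have coord j : (B *m col j D) i 0 = (i == j)%:R.
  by rewrite colE mulmxA BD mul1mx !mxE andbT.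
split.
- move/eqP; rewrite -subv0 -memvE memv0 => /eqP d0; move: (coord i).
  by rewrite d0 mulmx0 mxE eqxx => /esym/eqP; rewrite oner_eq0.
- apply/eqP; rewrite -subv0; apply/subvP=> _ /memv_capP[/vlineP[a ->]].
  case/memv_sumP=> v vP e; suff ->: a = 0 by rewrite scale0r mem0v.
  have := coord i; rewrite eqxx => c1.
  (* Coordinate [i] of the common vector is [a] on one side and 0 on the other, where column [i] is
     absent. *)
  have <- : (B *m (a *: col i D)) i 0 = a by rewrite -scalemxAr mxE c1 mulr1.
  rewrite e mulmx_sumr summxE big1 // => j ji.
  have /vlineP[b ->] := vP j ji.
  by rewrite -scalemxAr mxE coord eq_sym (negPf ji) mulr0.
Qed.

Theorem theorem6 (R : realType) (n q p : nat)
  (A : 'M[symbol]_n) (L : 'M[symbol]_(n, q)) (C : 'M[symbol]_(p, n))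
  (eta : 'I_q -> nat)
  (eta_index : forall i : 'I_q, is_index A (col i L) C (eta i))
  (full_rank : pattern_full_column_rank R (index_pattern A L C eta)) :
  FDI_solvable R A L C.
Proof.
move=> A0 L0 C0 A0P L0P C0P.
pose k i := (eta i - 1)%N.
have CAL_class j i :
    in_pattern_class (C *m A ^+ j *m col i L) (C0 *m A0 ^+ j *m col i L0).
  apply: in_pattern_class_mulmx; last exact: in_pattern_class_col.
  by apply: in_pattern_class_mulmx => //; apply: in_pattern_class_exp.
have CAL0 i j : (j < k i)%N -> C0 *m A0 ^+ j *m col i L0 = 0.
  rewrite ltn_subRL add1n => lt_j; apply: in_pattern_class0.
  by have [_ /(_ j lt_j) <- _] := eta_index i; apply: CAL_class.
pose D : 'M[R]_(p, q) := \matrix_(r, i) (C0 *m A0 ^+ k i *m col i L0) r 0.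
have colD i : col i D = C0 *m A0 ^+ k i *m col i L0.
  by apply/colP=> r; rewrite !mxE.
(* [D] belongs to the class of the index pattern, so [full_rank] applies to it. *)
have rankD : \rank D = q.
  apply: full_rank => r i; rewrite [D r i]mxE [index_pattern _ _ _ _ r i]mxE.
  exact: CAL_class.
have [B BD] := full_column_rank_left_inverse rankD.
pose W : 'M[R]_(n, q) := \matrix_(r, i) (A0 ^+ (k i).+1 *m col i L0) r 0.
have colW i : col i W = A0 ^+ (k i).+1 *m col i L0.
  by apply/colP=> r; rewrite !mxE.
(* Since [B *m D = 1%:M], this choice gives [G *m D = - W], which is [G_stop] read column by
   column. *)
pose G := - (W *m B).
have G_stop i : G *m (C0 *m A0 ^+ k i *m col i L0) = - (A0 ^+ (k i).+1 *m col i L0).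
  by rewrite -colD -colW !colE mulNmx mulmxA -(mulmxA W) BD mulmx1.
exists G, (fun i => <<chain A0 (col i L0) (k i)>>%VS); split=> i.
  exact: chain_smallest_invariant (CAL0 i) (G_stop i).
have CV j : (mxlin C0 @: <<chain A0 (col j L0) (k j)>>)%VS = <[col j D]>%VS.
  by rewrite colD; apply: output_chain (CAL0 j).
have [Di0 Dicap] := independent_lines rankD i.
by rewrite CV; split=> //; under eq_bigr do rewrite CV.
Qed.
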